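(* Let $R$ be a ring and let $\mathcal{F}$ be a divisible right Oka family in $R$. Let $\mathcal{F}'$ be the set of right ideals of $R$ not in $\mathcal{F}$, and let $\operatorname{Max}(\mathcal{F}')$ be the set of elements of $\mathcal{F}'$ maximal with respect to inclusion. Then every $P\in\operatorname{Max}(\mathcal{F}')$ is a comonoform right ideal.
   Context: Rings are associative with $1$, modules are unital. For an element $m$ and a submodule $N$ of a right $R$-module $M$, put $m^{-1}N:=\{r\in R: mr\in N\}$; in particular $a^{-1}I=\{r\in R: ar\in I\}$ for a right ideal $I$ and $a\in R$. A right Oka family in $R$ is a family $\mathcal{F}$ of right ideals of $R$ with $R\in\mathcal{F}$ such that for every right ideal $I$ and every $a\in R$: if $I+aR\in\mathcal{F}$ and $a^{-1}I\in\mathcal{F}$, then $I\in\mathcal{F}$. A family $\mathcal{F}$ of right ideals is divisible if for all $a\in R$, $I\in\mathcal{F}$ implies $a^{-1}I\in\mathcal{F}$. A submodule $N\subseteq M$ is dense in $M$ if for all $x,y\in M$ with $x\neq 0$, $x\cdot(y^{-1}N)\neq 0$. A nonzero right module $M$ is monoform if every nonzero submodule of $M$ is dense in $M$ (equivalently, for every submodule $C\subseteq M$, every nonzero homomorphism $C\to M$ is injective). A right ideal $P\subsetneq R$ is comonoform if the right module $R/P$ is monoform. *)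

(* Defs.v *)
From HB Require Import structures.
From mathcomp Require Import all_boot all_algebra.
From mathcomp Require Import boolp classical_sets.

Set Implicit Arguments.
Unset Strict Implicit.
Unset Printing Implicit Defensive.

Import GRing.Theory.
Local Open Scope ring_scope.
Local Open Scope quotient_scope.

(* lmodType only provides left modules: a right R-module is a left module over
   the converse ring R^c, so that [r *: m] stands for the product m r. *)
Notation rmodType R := (lmodType (R%type)^c).

(* R as a right module over itself. *)
Notation rregular R := (((R%type)^c)^o).

Lemma rregular_scaleE (R : pzRingType) (r : R^c) (a : rregular R) :
  r *: a = ((a : R) * (r : R) : R).
Proof. by []. Qed.

(* The library's bool-valued submodules are all submodules, as asbool decides
   membership in an arbitrary set. *)
Notation right_ideal R := (submodClosed (rregular R)).

Lemma submodClosed_ext (R : pzRingType) (V : lmodType R)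
    (N N' : submodClosed V) : N =i N' -> N = N'.
Proof.
case: N N' => [S [[S0D] [SZ]]] [S' [[S0D'] [SZ']]] eqS.
have {}eqS : S = S' by apply: funext => x; exact: eqS.
subst S'.
by rewrite (Prop_irrelevance S0D' S0D) (Prop_irrelevance SZ' SZ).
Qed.

Section QuotientModule.
Variables (R : pzRingType) (V : lmodType R) (N : submodClosed V).

Lemma submod_zmod_closed : zmod_closed N.
Proof.
split=> [|x y Nx Ny]; first exact: rpred0.
by rewrite -scaleN1r rpredD ?rpredZ.
Qed.

(* ring_quotient only forms quotients by a zmodClosed, which submodClosed does
   not extend. *)
Definition submod_zmodClosed : zmodClosed V :=
  HB.pack (GRing.SubmodClosed.sort N)
    (GRing.isZmodClosed.Build V (GRing.SubmodClosed.sort N) submod_zmod_closed).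

(* The additive group of quot_mod is the library's quotient; only the action
   of R is added below. *)
Definition quot_mod : Type := Quotient.quot submod_zmodClosed.

HB.instance Definition _ := GRing.Zmodule.on quot_mod.
HB.instance Definition _ := EqQuotient.on quot_mod.

Definition quot_scale (a : R) := lift_op1 quot_mod ( *:%R a).

Lemma pi_quotD : {morph \pi_quot_mod : x y / x + y}.
Proof. exact: (raddfD (\pi_(Quotient.quot submod_zmodClosed))). Qed.

Lemma pi_quot_scale (a : R) :
  {morph \pi_quot_mod : x / a *: x >-> quot_scale a x}.
Proof.
move=> x; rewrite /quot_scale; unlock; apply/eqP.
rewrite -[_ == _](Quotient.idealrBE submod_zmodClosed) -scalerBr.
apply: (rpredZ (s := N)); rewrite [_ \in _](Quotient.idealrBE submod_zmodClosed).
by rewrite reprK.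
Qed.

Lemma quot_scalerA (a b : R) (x : quot_mod) :
  quot_scale a (quot_scale b x) = quot_scale (a * b) x.
Proof. by elim/quotW: x => x; rewrite -!pi_quot_scale scalerA. Qed.

Lemma quot_scale1r : left_id 1 quot_scale.
Proof. by elim/quotW=> x; rewrite -pi_quot_scale scale1r. Qed.

Lemma quot_scalerDr : right_distributive quot_scale +%R.
Proof.
move=> a; elim/quotW=> x; elim/quotW=> y.
by rewrite -!pi_quot_scale -!pi_quotD -pi_quot_scale scalerDr.
Qed.

Lemma quot_scalerDl (x : quot_mod) : {morph quot_scale^~ x : a b / a + b}.
Proof.
by elim/quotW: x => x a b; rewrite -!pi_quot_scale -pi_quotD scalerDl.
Qed.

HB.instance Definition _ := GRing.Zmodule_isLmodule.Build R quot_mod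
  quot_scalerA quot_scale1r quot_scalerDr quot_scalerDl.

End QuotientModule.

Section Constructions.
Variables (R : pzRingType) (M : rmodType R).

Definition submod_full : {pred M} := predT.

Lemma submod_full_closed : GRing.subsemimod_closed submod_full.
Proof. by []. Qed.

HB.instance Definition _ :=
  GRing.isSubmodClosed.Build R^c M submod_full submod_full_closed.

(* m^-1 N *)
Definition colon (m : M) (N : submodClosed M) : {pred rregular R} :=
  fun r => (r : R^c) *: m \in N.

Lemma colon_closed m N : GRing.subsemimod_closed (colon m N).
Proof.
split; first split.
- by rewrite unfold_in /colon scale0r rpred0.
- by move=> r s Nr Ns; rewrite unfold_in /colon scalerDl rpredD.
- by move=> a r Nr; rewrite unfold_in /colon -scalerA rpredZ.
Qed.

HB.instance Definition _ m N := GRing.isSubmodClosed.Build R^c (rregular R)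
  (colon m N) (colon_closed m N).

(* N + mR *)
Definition add_cyclic (N : submodClosed M) (m : M) : {pred M} :=
  fun x => `[< exists n (r : R^c), n \in N /\ x = n + r *: m >].

Lemma add_cyclic_closed N m : GRing.subsemimod_closed (add_cyclic N m).
Proof.
split; first split.
- by apply/asboolP; exists 0, 0; rewrite rpred0 scale0r addr0.
- move=> x y /asboolP[n [r [Nn ->]]] /asboolP[n' [r' [Nn' ->]]].
  by apply/asboolP; exists (n + n'), (r + r'); rewrite rpredD// scalerDl addrACA.
- move=> a x /asboolP[n [r [Nn ->]]].
  by apply/asboolP; exists (a *: n), (a * r); rewrite rpredZ// scalerDr scalerA.
Qed.

HB.instance Definition _ N m := GRing.isSubmodClosed.Build R^c M
  (add_cyclic N m) (add_cyclic_closed N m).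

End Constructions.

Section Families.
Variable R : pzRingType.
Implicit Types (F : set (right_ideal R)) (I J P : right_ideal R).

Definition right_Oka F : Prop :=
  F (submod_full (M := rregular R)) /\
  forall I (a : rregular R), F (add_cyclic I a) -> F (colon a I) -> F I.

Definition divisible F : Prop :=
  forall (a : rregular R) I, F I -> F (colon a I).

Definition Max F : set (right_ideal R) :=
  [set P | F P /\ forall J, F J -> {subset P <= J} -> J = P].

End Families.

Section Monoform.
Variable R : pzRingType.

Definition dense (M : rmodType R) (N : submodClosed M) : Prop :=
  forall x y : M, x != 0 ->
    exists2 r : R^c, r \in colon y N & r *: x != 0.

Definition monoform (M : rmodType R) : Prop :=
  (exists x : M, x != 0) /\
  forall N : submodClosed M, (exists2 x, x \in N & x != 0) -> dense N.

Definition comonoform (P : right_ideal R) : Prop :=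
  (exists r, r \notin P) /\ monoform (quot_mod P).

End Monoform.

(* Main.v *)
Require Import Defs.
From HB Require Import structures.
From mathcomp Require Import all_boot all_algebra.
From mathcomp Require Import boolp classical_sets.

(** Let P be maximal outside F.  Every right ideal strictly above P lies in F;
    in particular P + xR does for each x outside P, so the Oka property forbids
    x^-1 P from lying in F.

    Suppose that R/P were not monoform.  Then some right ideal I strictly above
    P, some x outside P and some y satisfy y^-1 I <= x^-1 P.  This inclusion says
    that y r + i |-> x r + P is a well-defined map from yR + I to R/P.  Its
    kernel is J = I + y (x^-1 P), and a scalar sends y into the kernel exactly
    when it kills the image x + P of y, so that y^-1 J = x^-1 P
    ([colon_add_colon]).  Now J is strictly above P, hence in F, and
    divisibility puts x^-1 P = y^-1 J in F, a contradiction
    ([Max_dense]).  Passing from R to R/P only requires the correspondence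
    between submodules of R/P and right ideals above P. *)

Set Implicit Arguments.
Unset Strict Implicit.
Unset Printing Implicit Defensive.

Import GRing.Theory.
Local Open Scope ring_scope.
Local Open Scope quotient_scope.

Section AddColon.
Variables (R : pzRingType) (M : rmodType R).
Implicit Types (N P : submodClosed M) (x y : M).

Lemma in_colon N x (r : R^c) : (r \in colon x N) = (r *: x \in N).
Proof. by []. Qed.

(** The submodule N + y (x^-1 P). *)
Definition add_colon N P x y : {pred M} :=
  fun z => `[< exists2 s : R^c, s *: x \in P & z - s *: y \in N >].

Lemma add_colon_closed N P x y : GRing.subsemimod_closed (add_colon N P x y).
Proof.
split; first split.
- by apply/asboolP; exists 0; rewrite !scale0r ?subr0 rpred0.
- move=> z z' /asboolP[s Ps Nz] /asboolP[s' Ps' Nz'].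
  apply/asboolP; exists (s + s'); rewrite scalerDl; first exact: rpredD.
  by rewrite opprD addrACA; apply: rpredD.
- move=> a z /asboolP[s Ps Nz].
  apply/asboolP; exists (a * s); rewrite -scalerA; first exact: rpredZ.
  by rewrite -scalerBr; apply: rpredZ.
Qed.

HB.instance Definition _ N P x y := GRing.isSubmodClosed.Build R^c M
  (add_colon N P x y) (add_colon_closed N P x y).

Lemma sub_add_colon N P x y : {subset N <= add_colon N P x y}.
Proof.
by move=> z Nz; apply/asboolP; exists 0; rewrite !scale0r ?subr0 ?rpred0.
Qed.

(** The hypothesis makes y r + n |-> x r + P well defined on yR + N;
    [add_colon N P x y] is its kernel, so r sends y into the kernel exactly
    when it sends x into P. *)
Lemma colon_add_colon N P x y : {subset colon y N <= colon x P} ->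
  colon y (add_colon N P x y) =i colon x P.
Proof.
move=> sub r; apply/idP/idP => [/asboolP[s Ps Nrs] | Pr].
  have /sub : (r : R^c) - s \in colon y N by rewrite in_colon scalerBl.
  rewrite !in_colon scalerBl => Prs.
  by rewrite -[r *: x](subrK (s *: x)); apply: rpredD.
by apply/asboolP; exists r; rewrite // subrr rpred0.
Qed.

End AddColon.

Section QuotientCorrespondence.
Variables (R : pzRingType) (V : lmodType R) (P : submodClosed V).

Lemma pi_quot_eq0 (x : V) : (\pi_(quot_mod P) x == 0) = (x \in P).
Proof.
have <- : \pi_(quot_mod P) 0 = 0.
  exact: (raddf0 (\pi_(Quotient.quot (submod_zmodClosed P)))).
rewrite -[_ == _](Quotient.idealrBE (submod_zmodClosed P)).
by rewrite subr0.
Qed.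

Lemma pi_quotZ (a : R) (x : V) :
  \pi_(quot_mod P) (a *: x) = a *: \pi_(quot_mod P) x.
Proof. exact: pi_quot_scale. Qed.

Definition pi_preim (N : submodClosed (quot_mod P)) : {pred V} :=
  fun x => \pi_(quot_mod P) x \in N.

Lemma pi_preim_closed N : GRing.subsemimod_closed (pi_preim N).
Proof.
split; first split.
- have /eqP pi0 : \pi_(quot_mod P) 0 == 0 by rewrite pi_quot_eq0 rpred0.
  by rewrite unfold_in /pi_preim pi0 rpred0.
- by move=> x y Nx Ny; rewrite unfold_in /pi_preim pi_quotD rpredD.
- by move=> a x Nx; rewrite unfold_in /pi_preim pi_quotZ rpredZ.
Qed.

HB.instance Definition _ N := GRing.isSubmodClosed.Build R V
  (pi_preim N) (pi_preim_closed N).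

Lemma in_pi_preim N x : (x \in pi_preim N) = (\pi_(quot_mod P) x \in N).
Proof. by []. Qed.

Lemma sub_pi_preim N : {subset P <= pi_preim N}.
Proof.
move=> x; rewrite -pi_quot_eq0 => /eqP pix0.
by rewrite in_pi_preim pix0 rpred0.
Qed.

End QuotientCorrespondence.

Section MaxComplement.
Variables (R : pzRingType) (F : set (right_ideal R)) (P : right_ideal R).
Hypotheses (F_Oka : right_Oka F) (maxP : Max (~` F)%classic P).

Lemma Max_above (I : right_ideal R) :
  {subset P <= I} -> (exists2 t, t \in I & t \notin P) -> F I.
Proof.
move=> sPI [t It Pt]; have [_ max] := maxP; apply: contrapT => nFI.
by move: Pt; rewrite -(max I nFI sPI) It.
Qed.

Lemma Max_colon (x : rregular R) : x \notin P -> ~ F (colon x P).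
Proof.
move=> Px Fx; have [nFP _] := maxP; apply/nFP/(F_Oka.2 _ x) => //.
apply: Max_above => [z Pz|].
  by apply/asboolP; exists z, 0; rewrite scale0r addr0.
by exists x => //; apply/asboolP; exists 0, 1; rewrite rpred0 scale1r add0r.
Qed.

Lemma Max_proper : exists r, r \notin P.
Proof.
have [nFP _] := maxP; apply: contrapT => allP; apply: nFP.
have -> : P = submod_full (M := rregular R).
  apply: submodClosed_ext => r; rewrite [RHS]/=.
  by apply: contrapT => Pr; apply: allP; exists r; apply/negP => Pr'; apply: Pr.
exact: F_Oka.1.
Qed.

(** Density of I/P in R/P, read in R.  F need not be closed under larger right
    ideals, so y^-1 I in F and y^-1 I <= x^-1 P would not suffice: I has to be
    enlarged until the last inclusion is an equality. *)
Lemma Max_dense (F_div : divisible F) (I : right_ideal R) (x y : rregular R) :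
    {subset P <= I} -> (exists2 t, t \in I & t \notin P) -> x \notin P ->
  exists2 r : R^c, r *: y \in I & r *: x \notin P.
Proof.
move=> sPI [t It Pt] Px; apply: contrapT => nex.
have sub : {subset colon y I <= colon x P}.
  move=> r Ir; apply: contrapT => Pr; apply: nex.
  by exists r => //; apply/negP.
apply: (Max_colon Px).
rewrite -(submodClosed_ext (colon_add_colon sub)).
apply: F_div; apply: Max_above => [z /sPI|]; first exact: sub_add_colon.
by exists t => //; apply: sub_add_colon.
Qed.

End MaxComplement.

Theorem theorem6p10 (R : pzRingType) (F : set (right_ideal R))
    (F_Oka : right_Oka F) (F_div : divisible F) (P : right_ideal R) :
  Max (~` F)%classic P -> comonoform P.
Proof.
move=> maxP; have [r Pr] := Max_proper F_Oka maxP.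
split; first by exists r.
split; first by exists (\pi_(quot_mod P) r); rewrite pi_quot_eq0.
move=> N [n Nn n0] x y; elim/quotW: x => x; elim/quotW: y => y.
rewrite pi_quot_eq0 => Px.
have [|s Ns Ps] := Max_dense F_Oka maxP F_div y (@sub_pi_preim _ _ P N) _ Px.
  by exists (repr n); [rewrite in_pi_preim reprK | rewrite -pi_quot_eq0 reprK].
exists s; last by rewrite -pi_quotZ pi_quot_eq0.
by rewrite in_colon -pi_quotZ.
Qed.
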